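(* Let $G$ be a compact (Hausdorff) topological group possessing a split spherical BN-pair $(B,N)$ (with $B,N$ not necessarily closed). Then the associated building $\Delta(G,B)$ is finite; equivalently $[G:B]<\infty$.
   Context: A BN-pair for a group $G$ is a pair of subgroups $B,N$ generating $G$ such that $T:=B\cap N$ is normal in $N$ and $W:=N/T$ is generated by a finite set $S$ of involutions satisfying the usual BN-pair axioms; it is spherical if $W$ is finite. It is split if it is saturated, i.e. $T=\bigcap_{w\in W}wBw^{-1}$, and there exists a nilpotent normal subgroup $U\trianglelefteq B$ with $B=U\rtimes T$. The building $\Delta(G,B)$ has chamber set $G/B$. *)

(* Defs.v *)
From Stdlib Require Import List Classical.
Import ListNotations.

Set Implicit Arguments.

Record Group := {
  gcar :> Type;
  gmul : gcar -> gcar -> gcar;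
  ginv : gcar -> gcar;
  gone : gcar;
  gmulA : forall x y z, gmul x (gmul y z) = gmul (gmul x y) z;
  gmul1l : forall x, gmul gone x = x;
  gmul1r : forall x, gmul x gone = x;
  gmulVl : forall x, gmul (ginv x) x = gone;
  gmulVr : forall x, gmul x (ginv x) = gone
}.

Arguments gmul {g} _ _.
Arguments ginv {g} _.
Arguments gone {g}.

Section GroupDefs.
Variable G : Group.

Definition subset := G -> Prop.

Definition is_subgroup (H : subset) : Prop :=
  H gone /\ (forall x y, H x -> H y -> H (gmul x y)) /\
  (forall x, H x -> H (ginv x)).

Definition gen (A : subset) : subset :=
  fun x => forall H : subset, is_subgroup H -> (forall a, A a -> H a) -> H x.

Definition normal_in (H K : subset) : Prop :=
  is_subgroup H /\ is_subgroup K /\ (forall x, H x -> K x) /\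
  (forall k h, K k -> H h -> H (gmul (ginv k) (gmul h k))).

Definition commutator (x y : G) : G :=
  gmul (ginv x) (gmul (ginv y) (gmul x y)).

Fixpoint lcs (U : subset) (i : nat) : subset :=
  match i with
  | O => U
  | S j => gen (fun z => exists x y, lcs U j x /\ U y /\ z = commutator x y)
  end.

Definition nilpotent (U : subset) : Prop :=
  is_subgroup U /\ exists n, forall x, lcs U n x -> x = gone.

(** ** BN-pairs (Tits systems).
   T := B ∩ N, W := N/T.  The finite generating set S of involutions of W
   is given by a finite list of representatives in N. *)
Definition BN_T (B N : subset) : subset := fun x => B x /\ N x.

Definition is_BN_pair (B N : subset) (S : list G) : Prop :=
  let T := BN_T B N in
  is_subgroup B /\ is_subgroup N /\
  (forall g : G, gen (fun x => B x \/ N x) g) /\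
  normal_in T N /\
  (* elements of S represent involutions of W = N/T *)
  (forall s, In s S -> N s /\ ~ T s /\ T (gmul s s)) /\
  (* S generates W, i.e. N is generated by T together with S *)
  (forall n, N n -> gen (fun x => T x \/ In x S) n) /\
  (forall s w b, In s S -> N w -> B b ->
     exists b1 b2, B b1 /\ B b2 /\
       (gmul s (gmul b w) = gmul b1 (gmul w b2) \/
        gmul s (gmul b w) = gmul b1 (gmul (gmul s w) b2))) /\
  (forall s, In s S ->
     ~ (forall x, (exists b, B b /\ x = gmul s (gmul b s)) <-> B x)).

(** spherical: W = N/T is finite *)
Definition BN_spherical (B N : subset) : Prop :=
  exists l : list G, (forall w, In w l -> N w) /\
    forall n, N n -> exists w, In w l /\ BN_T B N (gmul (ginv w) n).

(** split: saturated and B = U ⋊ T with U nilpotent normal in B *)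
Definition BN_split (B N : subset) : Prop :=
  let T := BN_T B N in
  (forall x, T x <-> (forall n, N n -> B (gmul (ginv n) (gmul x n)))) /\
  exists U : subset,
    nilpotent U /\ normal_in U B /\
    (forall x, U x -> T x -> x = gone) /\
    (forall b, B b -> exists u t, U u /\ T t /\ b = gmul u t).

Definition finite_index (B : subset) : Prop :=
  exists l : list G, forall g : G, exists x, In x l /\ B (gmul (ginv x) g).

End GroupDefs.

Record TopGroup := {
  tgrp :> Group;
  topen : (tgrp -> Prop) -> Prop;
  topen_full : topen (fun _ => True);
  topen_inter : forall U V, topen U -> topen V -> topen (fun x => U x /\ V x);
  topen_union : forall (I : Type) (F : I -> tgrp -> Prop),
      (forall i, topen (F i)) -> topen (fun x => exists i, F i x);
  tmul_cont : forall (O : tgrp -> Prop) x y, topen O -> O (gmul x y) ->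
      exists V W, topen V /\ topen W /\ V x /\ W y /\
        (forall a b, V a -> W b -> O (gmul a b));
  tinv_cont : forall (O : tgrp -> Prop) x, topen O -> O (ginv x) ->
      exists V, topen V /\ V x /\ (forall a, V a -> O (ginv a))
}.

Definition hausdorff (G : TopGroup) : Prop :=
  forall x y : G, x <> y -> exists U V, topen G U /\ topen G V /\ U x /\ V y /\
    (forall z, U z -> V z -> False).

Definition compact (G : TopGroup) : Prop :=
  forall (I : Type) (F : I -> G -> Prop), (forall i, topen G (F i)) ->
    (forall x, exists i, F i x) ->
    exists l : list I, forall x, exists i, In i l /\ F i x.

(* Main.v *)
Require Import Defs.
From Stdlib Require Import List Classical Arith Lia.

Set Implicit Arguments.
Unset Strict Implicit.

(** A closed [B] is open: by sphericity and the Bruhat decomposition its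
    complement is a finite union of double cosets [B w B], each of which is
    closed because [B] is compact.  An open subgroup of a compact group has
    finite index.

    To see that [B] is closed, consider the descending chain consisting of the
    closure of [B] followed by the closures of the terms of the lower central
    series of [U].  It ends in the trivial group, and commutators of its [i]-th
    term with [U] lie in the next term.  If [B] is not closed, some term is not
    contained in [B] while the next one is.  An element [g] outside [B] of the
    former term satisfies [g U g^-1 <= B]; the [N]-part [n] of [g] in
    [G = B N B] then satisfies [n B n^-1 <= B] because [B = U T], and this
    forces [n] into [T] by the length function on [W]. *)

Declare Scope grp_scope.
Local Notation "x * y" := (gmul x y) : grp_scope.
Local Notation "x ^-1" := (ginv x) (at level 3, format "x ^-1") : grp_scope.
Local Open Scope grp_scope.

(** * Group identities and their normalisation *)

Section GroupLaws.
Variable G : Group.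
Implicit Types x y z : G.

Lemma mulgA_rev x y z : (x * y) * z = x * (y * z).
Proof. symmetry. apply gmulA. Qed.

Lemma mulKg x y : x^-1 * (x * y) = y.
Proof. now rewrite gmulA, gmulVl, gmul1l. Qed.

Lemma mulVKg x y : x * (x^-1 * y) = y.
Proof. now rewrite gmulA, gmulVr, gmul1l. Qed.

Lemma invg_unique x y : x * y = gone -> x^-1 = y.
Proof. intros H. now rewrite <- (gmul1r _ (x^-1)), <- H, mulKg. Qed.

Lemma invgK x : (x^-1)^-1 = x.
Proof. apply invg_unique, gmulVl. Qed.

Lemma invMg x y : (x * y)^-1 = y^-1 * x^-1.
Proof. apply invg_unique. now rewrite mulgA_rev, mulVKg, gmulVr. Qed.

Lemma invg1 : (gone : G)^-1 = gone.
Proof. apply invg_unique, gmul1l. Qed.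

End GroupLaws.

#[local] Hint Rewrite mulgA_rev mulKg mulVKg invgK invMg invg1
  gmul1l gmul1r gmulVl gmulVr : grp.
Ltac group := autorewrite with grp; reflexivity.

Lemma subgroup_gen (G : Group) (A : subset G) : is_subgroup (gen A).
Proof.
  repeat split.
  - intros H [H1 _] _; exact H1.
  - intros x y Hx Hy H HH HA. pose proof HH as [_ [HM _]].
    apply HM; [apply Hx | apply Hy]; assumption.
  - intros x Hx H HH HA. pose proof HH as [_ [_ HV]].
    apply HV, Hx; assumption.
Qed.

(** * Lengths and the Bruhat decomposition *)

Section BNPair.
Variable G : Group.
Variables (B N : subset G) (S : list G).
Hypothesis BN : is_BN_pair B N S.
Implicit Types (s t w n b : G) (j k : nat).

Local Notation T := (BN_T B N).

Lemma B_one : B gone.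
Proof. destruct BN as [[H _] _]. exact H. Qed.
Lemma B_mul x y : B x -> B y -> B (x * y).
Proof. destruct BN as [[_ [H _]] _]. apply H. Qed.
Lemma B_inv x : B x -> B x^-1.
Proof. destruct BN as [[_ [_ H]] _]. apply H. Qed.
Lemma N_one : N gone.
Proof. destruct BN as [_ [[H _] _]]. exact H. Qed.
Lemma N_mul x y : N x -> N y -> N (x * y).
Proof. destruct BN as [_ [[_ [H _]] _]]. apply H. Qed.
Lemma N_inv x : N x -> N x^-1.
Proof. destruct BN as [_ [[_ [_ H]] _]]. apply H. Qed.
Lemma T_mul x y : T x -> T y -> T (x * y).
Proof. intros [] []; split; [apply B_mul | apply N_mul]; assumption. Qed.
Lemma T_inv x : T x -> T x^-1.
Proof. intros []; split; [apply B_inv | apply N_inv]; assumption. Qed.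
Lemma T_conj n t : N n -> T t -> T (n^-1 * (t * n)).
Proof. destruct BN as [_ [_ [_ [[_ [_ [_ H]]] _]]]]. apply H. Qed.
Lemma T_conjV n t : N n -> T t -> T (n * (t * n^-1)).
Proof.
  intros Hn Ht. rewrite <- (invgK n) at 1. apply T_conj; [apply N_inv|]; assumption.
Qed.
Lemma S_N s : In s S -> N s.
Proof. destruct BN as [_ [_ [_ [_ [H _]]]]]. apply H. Qed.
Lemma S_notT s : In s S -> ~ T s.
Proof. destruct BN as [_ [_ [_ [_ [H _]]]]]. apply H. Qed.
Lemma S_sq s : In s S -> T (s * s).
Proof. destruct BN as [_ [_ [_ [_ [H _]]]]]. apply H. Qed.
Lemma N_gen n : N n -> gen (fun x => T x \/ In x S) n.
Proof. destruct BN as [_ [_ [_ [_ [_ [H _]]]]]]. apply H. Qed.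

(** An [s] in [S] only represents an involution of [W], so in [G] its inverse agrees with [s] up to
    the element [(s * s)^-1] of [T]. *)
Lemma S_invE s : s^-1 = s * (s * s)^-1.
Proof. group. Qed.

(** * Double cosets of [B] *)

Definition double_coset w x := exists b1 b2, B b1 /\ B b2 /\ x = b1 * (w * b2).

Lemma double_coset_refl w : double_coset w w.
Proof. exists gone, gone. repeat split; try apply B_one. group. Qed.

Lemma double_coset_mulr w x b : double_coset w x -> B b -> double_coset w (x * b).
Proof.
  intros (b1 & b2 & H1 & H2 & ->) Hb. exists b1, (b2 * b).
  repeat split; auto using B_mul. group.
Qed.

Lemma double_coset_mull w x b : double_coset w x -> B b -> double_coset w (b * x).
Proof.
  intros (b1 & b2 & H1 & H2 & ->) Hb. exists (b * b1), b2.
  repeat split; auto using B_mul. group.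
Qed.

Lemma double_coset_sym w x : double_coset w x -> double_coset x w.
Proof.
  intros (b1 & b2 & H1 & H2 & ->). exists b1^-1, b2^-1.
  repeat split; auto using B_inv. group.
Qed.

Lemma double_coset_trans w x y : double_coset w x -> double_coset x y -> double_coset w y.
Proof.
  intros H (b1 & b2 & H1 & H2 & ->).
  apply double_coset_mull, H1. apply double_coset_mulr, H2. exact H.
Qed.

Lemma double_coset_inv w x : double_coset w x -> double_coset w^-1 x^-1.
Proof.
  intros (b1 & b2 & H1 & H2 & ->). exists b2^-1, b1^-1.
  repeat split; auto using B_inv. group.
Qed.

Lemma S_mul_double_coset s w b : In s S -> N w -> B b ->
  double_coset w (s * (b * w)) \/ double_coset (s * w) (s * (b * w)).
Proof.
  destruct BN as [_ [_ [_ [_ [_ [_ [H _]]]]]]]. intros Hs Hw Hb.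
  destruct (H s w b Hs Hw Hb) as (b1 & b2 & H1 & H2 & [E | E]);
    [left | right]; exists b1, b2; auto.
Qed.

(** Right-handed form of the exchange axiom, obtained by applying it to [w^-1] and [b^-1] and
    inverting; this is why [s^-1] appears. *)
Lemma double_coset_mul_SV s w b : In s S -> N w -> B b ->
  double_coset w (w * (b * s^-1)) \/ double_coset (w * s^-1) (w * (b * s^-1)).
Proof.
  intros Hs Hw Hb.
  destruct (S_mul_double_coset Hs (N_inv Hw) (B_inv Hb)) as [E | E];
    [left | right]; apply double_coset_inv in E;
    autorewrite with grp in E; exact E.
Qed.

(** The axiom only excludes the equality [s B s = B], but since [s * s] lies in [B], the inclusion
    would already force equality. *)
Lemma S_not_normalize_B s : In s S -> ~ (forall b, B b -> B (s * (b * s))).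
Proof.
  intros Hs H. destruct BN as [_ [_ [_ [_ [_ [_ [_ H']]]]]]].
  apply (H' s Hs). intros x; split.
  - intros (b & Hb & ->). auto.
  - intros Hx. exists (s^-1 * (x * s^-1)). split; [|group].
    destruct (S_sq Hs) as [Hss _].
    replace (s^-1 * (x * s^-1))
      with ((s * s)^-1 * ((s * (x * s)) * (s * s)^-1)) by group.
    auto using B_mul, B_inv.
Qed.

(* [N_word k n]: the class of [n] in [W = N/T] is a product of [k] elements of [S],
   so its length is at least [k] iff no shorter word represents [n]. *)
Inductive N_word : nat -> G -> Prop :=
| N_word_T t : T t -> N_word 0 t
| N_word_S s k n : In s S -> N_word k n -> N_word (Datatypes.S k) (s * n).

Lemma N_word_N k n : N_word k n -> N n.
Proof. induction 1 as [t [] | ]; auto using N_mul, S_N. Qed.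

Lemma N_word_mulT k n t : N_word k n -> T t -> N_word k (n * t).
Proof.
  intros H; revert t. induction H as [t0 H0 | s k n Hs H IH]; intros t Ht.
  - constructor. auto using T_mul.
  - rewrite mulgA_rev. constructor; auto.
Qed.

Lemma N_word_Tmul k n t : N_word k n -> T t -> N_word k (t * n).
Proof.
  intros H Ht. replace (t * n) with (n * (n^-1 * (t * n))) by group.
  apply N_word_mulT; auto. apply T_conj; auto. eapply N_word_N; eauto.
Qed.

Lemma N_word_mul j k m n : N_word j m -> N_word k n -> N_word (j + k) (m * n).
Proof.
  intros H Hn. induction H as [t Ht | s j m Hs H IH]; simpl.
  - auto using N_word_Tmul.
  - rewrite mulgA_rev. constructor; auto.
Qed.

Lemma N_word_gen s : In s S -> N_word 1 s.
Proof.
  intros Hs. rewrite <- (gmul1r _ s). constructor; auto.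
  constructor. split; [apply B_one | apply N_one].
Qed.

Lemma N_word_mulS k n s : N_word k n -> In s S -> N_word (Datatypes.S k) (n * s).
Proof.
  intros H Hs. replace (Datatypes.S k) with (k + 1) by lia.
  auto using N_word_mul, N_word_gen.
Qed.

Lemma N_word_Smul_cancel k n s : In s S -> N_word k (s * n) -> N_word (Datatypes.S k) n.
Proof.
  intros Hs H. replace n with ((s * s)^-1 * (s * (s * n))) by group.
  apply N_word_Tmul; [constructor; auto | auto using T_inv, S_sq].
Qed.

Lemma N_word_inv k n : N_word k n -> N_word k n^-1.
Proof.
  induction 1 as [t Ht | s k n Hs H IH].
  - constructor. auto using T_inv.
  - rewrite invMg, (S_invE s), gmulA.
    apply N_word_mulT; [auto using N_word_mulS | auto using T_inv, S_sq].
Qed.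

(** Words end in an element of [T]; normality of [T] in [N] moves it to the left of the last
    letter. *)
Lemma N_word_rdecomp k w : N_word (Datatypes.S k) w ->
  exists w' s, In s S /\ N_word k w' /\ w = w' * s.
Proof.
  revert w. induction k as [|k IH]; intros w Hw;
    inversion Hw as [|s k' n Hs Hn]; subst.
  - inversion Hn; subst. exists (s * (n * s^-1)), s. repeat split; auto.
    + constructor. auto using T_conjV, S_N.
    + group.
  - destruct (IH n Hn) as (w' & t & Ht & Hw' & ->).
    exists (s * w'), t. repeat split; auto.
    + constructor; auto.
    + group.
Qed.

Lemma N_word_exists n : N n -> exists k, N_word k n.
Proof.
  intros Hn. apply (N_gen Hn (H := fun n => exists k, N_word k n)).
  - repeat split.
    + exists 0. constructor. split; [apply B_one | apply N_one].
    + intros x y [j Hj] [k Hk]. exists (j + k). auto using N_word_mul.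
    + intros x [k Hk]. exists k. auto using N_word_inv.
  - intros a [Ha | Ha].
    + exists 0. constructor; auto.
    + exists 1. auto using N_word_gen.
Qed.

Lemma N_word_minimal n : N n ->
  exists k, N_word k n /\ forall j, j < k -> ~ N_word j n.
Proof.
  intros Hn. destruct (N_word_exists Hn) as [k Hk].
  revert Hk. induction k as [k IH] using lt_wf_ind. intros Hk.
  destruct (classic (exists j, j < k /\ N_word j n)) as [(j & Hj & H) | H].
  - eauto.
  - exists k. split; auto. intros j Hj Hw. apply H. eauto.
Qed.

(** * Lengths in [W] and multiplication of double cosets *)

(** Distinct elements of [W] have distinct double cosets. Induction on a word [s * w1] for [w]: the
    axiom puts [w1] in [B w' B] or [B s w' B]. The first would make [w'] too short; the second
    reduces to the pair [w1], [s * w']. *)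
Lemma double_coset_inj k w w' :
  N_word k w -> N w' -> (forall j, j < k -> ~ N_word j w') ->
  double_coset w w' -> T (w^-1 * w').
Proof.
  revert w w'. induction k as [|k IH]; intros w w' Hw Hw' Hmin Hd;
    inversion Hw as [t Ht | s k' w1 Hs Hw1]; subst.
  - apply T_mul; [auto using T_inv|]. split; auto.
    destruct Hd as (b1 & b2 & H1 & H2 & ->).
    destruct Ht. auto using B_mul.
  - assert (H1 : double_coset w' w1 \/ double_coset (s * w') w1).
    { destruct Hd as (b1 & b2 & H1 & H2 & E).
      assert (Hb : B ((s * s)^-1 * b1^-1))
        by (destruct (S_sq Hs); auto using B_mul, B_inv).
      assert (E' : w1 = (s * (((s * s)^-1 * b1^-1) * w')) * b2^-1)
        by (rewrite E; group).
      rewrite E'.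
      destruct (S_mul_double_coset Hs Hw' Hb) as [D | D]; [left | right];
        apply double_coset_mulr; auto using B_inv. }
    destruct H1 as [H1 | H1]; apply double_coset_sym in H1; apply IH in H1; auto.
    + exfalso. apply (Hmin k); [lia|].
      replace w' with (w1 * (w1^-1 * w')) by group.
      auto using N_word_mulT.
    + replace ((s * w1)^-1 * w')
        with ((w1^-1 * ((s * s)^-1 * w1)) * (w1^-1 * (s * w'))) by group.
      apply T_mul; auto.
      apply T_conj; [eapply N_word_N; eauto | auto using T_inv, S_sq].
    + auto using N_mul, S_N.
    + intros j Hj Hs'. apply (Hmin (Datatypes.S j)); [lia|].
      eauto using N_word_Smul_cancel.
Qed.

(** If [s] does not shorten [w], the axiom's other alternative [B w B] is impossible. Write
    [w = w' * t] with [t] in [S]. Were [s b w] in [B w B], then [s b w'] would lie in [B w B] or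
    [B w' B], while by induction it lies in [B s w' B]. By injectivity [s w'] equals [w] or [w']
    modulo [T]: the former makes [s * w] too short, the latter puts [s] in [T]. *)
Lemma S_mul_double_coset_length k s w b :
  In s S -> N_word k w ->
  (forall j, j < k -> ~ N_word j w) -> (forall j, j < k -> ~ N_word j (s * w)) ->
  B b -> double_coset (s * w) (s * (b * w)).
Proof.
  revert w b. induction k as [|k IH]; intros w b Hs Hw Hmin Hsmin Hb.
  - inversion Hw as [t [Ht _] | ]; subst. exists gone, (w^-1 * (b * w)).
    repeat split; auto using B_one, B_mul, B_inv. group.
  - destruct (S_mul_double_coset Hs (N_word_N Hw) Hb) as [D | D]; auto.
    exfalso.
    destruct (N_word_rdecomp Hw) as (w' & t & Ht & Hw' & E).
    assert (Hmin' : forall j, j < k -> ~ N_word j w').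
    { intros j Hj H. apply (Hmin (Datatypes.S j)); [lia|].
      rewrite E. auto using N_word_mulS. }
    assert (Hsmin' : forall j, j < k -> ~ N_word j (s * w')).
    { intros j Hj H. apply (Hsmin (Datatypes.S j)); [lia|].
      rewrite E, gmulA. auto using N_word_mulS. }
    pose proof (IH w' b Hs Hw' Hmin' Hsmin' Hb) as D'.
    assert (HNw' : N w') by (eapply N_word_N; eauto).
    assert (D2 : double_coset w (s * (b * w')) \/ double_coset w' (s * (b * w'))).
    { destruct D as (b1 & b2 & H1 & H2 & ED).
      assert (E' : s * (b * w') = b1 * (w * (b2 * t^-1))).
      { replace (s * (b * w')) with ((s * (b * w)) * t^-1) by (rewrite E; group).
        rewrite ED. group. }
      rewrite E'.
      destruct (double_coset_mul_SV Ht (N_word_N Hw) H2) as [D | D];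
        [left | right]; apply double_coset_mull; auto.
      rewrite E in D |- *. autorewrite with grp in D |- *. exact D. }
    destruct D2 as [D2 | D2].
    + pose proof (double_coset_trans D' (double_coset_sym D2)) as D3.
      assert (HT : T ((s * w')^-1 * w)).
      { apply (double_coset_inj (k := Datatypes.S k)); auto.
        - constructor; auto.
        - eapply N_word_N; eauto. }
      apply (Hsmin k); [lia|].
      replace (s * w) with ((s * s) * (w' * ((s * w')^-1 * w))) by group.
      auto using N_word_Tmul, N_word_mulT, S_sq.
    + pose proof (double_coset_trans D2 (double_coset_sym D')) as D3.
      apply (double_coset_inj (k := k)) in D3; auto using N_mul, S_N.
      apply (S_notT Hs).
      replace s with (w' * ((w'^-1 * (s * w')) * w'^-1)) by group.
      auto using T_conjV.
Qed.

(** If a shortest word for [w] starts with [s], say [w = s * w'], then [s b w'] lies in [B w B].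
    Multiplying by [w'^-1 * s = w^-1 * (s * s)] shows [s b s] in [B], for every [b] in [B], which is
    excluded. *)
Lemma B_self_normalizing w : N w -> (forall b, B b -> B (w * (b * w^-1))) -> B w.
Proof.
  intros Hw Hn. destruct (N_word_minimal Hw) as (k & Hk & Hmin).
  inversion Hk as [t [Ht _] | s k' w' Hs Hw']; subst; auto.
  exfalso. apply (S_not_normalize_B Hs). intros b Hb.
  assert (D : double_coset (s * w') (s * (b * w'))).
  { apply (S_mul_double_coset_length (k := k')); auto.
    intros j Hj H. apply (Hmin (Datatypes.S j)); [lia|]. constructor; auto. }
  destruct D as (b1 & b2 & H1 & H2 & E).
  replace (s * (b * s))
    with (b1 * (((s * w') * (b2 * (s * w')^-1)) * (s * s))).
  - destruct (S_sq Hs). auto using B_mul.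
  - replace (s * (b * s)) with ((s * (b * w')) * (w'^-1 * s)) by group.
    rewrite E. group.
Qed.

(** * The Bruhat decomposition and conjugates of [U] *)

Lemma BNB_closed g : (B g \/ T g \/ In g S) -> forall n x, N n -> double_coset n x ->
  exists n', N n' /\ double_coset n' (g * x).
Proof.
  intros Hg n x Hn (b1 & b2 & H1 & H2 & ->).
  assert (HB : B g -> exists n', N n' /\ double_coset n' (g * (b1 * (n * b2)))).
  { intros HB. exists n; split; auto. exists (g * b1), b2.
    repeat split; auto using B_mul. group. }
  destruct Hg as [Hg | [[Hg _] | Hs]]; auto.
  replace (g * (b1 * (n * b2))) with ((g * (b1 * n)) * b2) by group.
  destruct (S_mul_double_coset Hs Hn H1) as [D | D];
    [exists n | exists (g * n)]; split; auto using N_mul, S_N, double_coset_mulr.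
Qed.

Lemma bruhat_decomposition g : exists n, N n /\ double_coset n g.
Proof.
  set (stab := fun g => forall n x, N n -> double_coset n x ->
                 exists n', N n' /\ double_coset n' (g * x)).
  (* Elements mapping [B N B] into itself form a monoid; requiring this of [g^-1] too makes it a
     subgroup, which contains the generators. *)
  set (H := fun g => stab g /\ stab g^-1).
  assert (HH : is_subgroup H).
  { assert (stab_mul : forall x y, stab x -> stab y -> stab (x * y)).
    { intros x y Hx Hy n z Hn Hz. destruct (Hy _ _ Hn Hz) as (n1 & Hn1 & D1).
      rewrite mulgA_rev. eauto. }
    assert (stab_one : stab gone).
    { intros n z Hn Hz. rewrite gmul1l. eauto. }
    repeat split; auto.
    - rewrite invg1. auto.
    - destruct H0, H1. auto.
    - rewrite invMg. destruct H0, H1. auto.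
    - apply H0.
    - rewrite invgK. apply H0. }
  assert (HB : forall b, B b -> H b).
  { intros b Hb. split; intros n x; apply BNB_closed; auto using B_inv. }
  assert (HS : forall s, In s S -> H s).
  { intros s Hs. assert (stab s) by (intros n x; apply BNB_closed; auto).
    split; auto. rewrite S_invE. intros n x Hn Hx. rewrite mulgA_rev.
    destruct (@BNB_closed (s * s)^-1) with (n := n) (x := x) as (n' & Hn' & D); eauto.
    right; left. auto using T_inv, S_sq. }
  assert (Hg : H g).
  { destruct BN as [_ [_ [Hgen _]]]. apply (Hgen g H HH).
    intros a [Ha | Ha]; auto. apply (N_gen Ha (H := H) HH).
    intros c [[Hc _] | Hc]; auto. }
  destruct Hg as [Hg _].
  destruct (Hg gone gone N_one (double_coset_refl gone)) as (n & Hn & D).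
  rewrite gmul1r in D. eauto.
Qed.

Lemma conj_U_in_B (U : subset G) g :
  normal_in U B -> (forall b, B b -> exists u t, U u /\ T t /\ b = u * t) ->
  (forall u, U u -> B (g * (u * g^-1))) -> B g.
Proof.
  intros (_ & _ & _ & HU) Hdec Hg.
  destruct (bruhat_decomposition g) as (n & Hn & b1 & b2 & H1 & H2 & ->).
  enough (B n) by auto using B_mul.
  (* [B] is [U T]: [n] normalises [T], and conjugation of [U] by [n] differs from that by [g] only
     through [b2], which preserves [U], and [b1], which preserves [B]. *)
  apply B_self_normalizing; auto. intros b Hb.
  destruct (Hdec b Hb) as (u & t & Hu & Ht & ->).
  replace (n * ((u * t) * n^-1)) with ((n * (u * n^-1)) * (n * (t * n^-1))) by group.
  apply B_mul; [|apply T_conjV; auto].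
  pose proof (Hg _ (HU _ _ H2 Hu)) as H.
  replace (n * (u * n^-1)) with
    (b1^-1 * ((b1 * (n * b2)) * ((b2^-1 * (u * b2)) * (b1 * (n * b2))^-1) * b1))
    by group.
  auto using B_mul, B_inv.
Qed.

End BNPair.

(** * Closures and neighbourhoods in topological groups *)

Section Topology.
Variable G : TopGroup.
Implicit Types (A : subset G) (x y z : G).

Definition closure A x := forall O, topen G O -> O x -> exists a, O a /\ A a.

Definition continuous (f : G -> G) := forall O x, topen G O -> O (f x) ->
  exists V, topen G V /\ V x /\ forall a, V a -> O (f a).

Lemma continuous_id : continuous (fun x => x).
Proof. intros O x HO Hx. exists O. auto. Qed.

Lemma continuous_const c : continuous (fun _ => c).
Proof.
  intros O x HO Hx. exists (fun _ => True). repeat split; auto. apply topen_full.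
Qed.

Lemma continuous_mul f g : continuous f -> continuous g ->
  continuous (fun x => f x * g x).
Proof.
  intros Hf Hg O x HO Hx.
  destruct (@tmul_cont G O _ _ HO Hx) as (V & W & HV & HW & Vf & Wg & H).
  destruct (Hf V x HV Vf) as (V1 & HV1 & V1x & H1).
  destruct (Hg W x HW Wg) as (W1 & HW1 & W1x & H2).
  exists (fun a => V1 a /\ W1 a). repeat split; auto.
  - apply topen_inter; auto.
  - intros a []; auto.
Qed.

Lemma continuous_inv f : continuous f -> continuous (fun x => (f x)^-1).
Proof.
  intros Hf O x HO Hx.
  destruct (@tinv_cont G O _ HO Hx) as (V & HV & Vf & H).
  destruct (Hf V x HV Vf) as (V1 & HV1 & V1x & H1). exists V1. auto.
Qed.

Lemma closure_map f A A' x : continuous f -> (forall a, A a -> A' (f a)) ->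
  closure A x -> closure A' (f x).
Proof.
  intros Hf HA Hx O HO Ox. destruct (Hf O x HO Ox) as (V & HV & Vx & H).
  destruct (Hx V HV Vx) as (a & Va & Aa). eauto.
Qed.

(** Separation keeps the closure of the last term of the chain trivial. *)
Lemma closure_trivial A x : hausdorff G -> (forall a, A a -> a = gone) ->
  closure A x -> x = gone.
Proof.
  intros haus HA Hx. apply NNPP. intros Hne.
  destruct (haus x gone Hne) as (O & O' & HO & HO' & Ox & O'1 & dis).
  destruct (Hx O HO Ox) as (a & Oa & Aa). rewrite (HA a Aa) in Oa. eauto.
Qed.

Lemma not_closure A x : ~ closure A x ->
  exists O, topen G O /\ O x /\ forall a, O a -> ~ A a.
Proof.
  intros H. apply not_all_ex_not in H. destruct H as [O H].
  apply imply_to_and in H. destruct H as [HO H].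
  apply imply_to_and in H. destruct H as [Ox H].
  exists O. repeat split; auto. intros a Oa Aa. apply H. eauto.
Qed.

Lemma nbhd_finite_inter (I : Type) (l : list I) (P : I -> G -> Prop) y :
  (forall i, In i l -> exists W, topen G W /\ W y /\ forall z, W z -> P i z) ->
  exists W, topen G W /\ W y /\ forall i z, In i l -> W z -> P i z.
Proof.
  induction l as [|i l IH]; intros H.
  - exists (fun _ => True). repeat split; auto; [apply topen_full | intros _ _ []].
  - destruct IH as (W & HW & Wy & HP); [intros j Hj; apply H; right; auto|].
    destruct (H i (or_introl eq_refl)) as (W' & HW' & W'y & HP').
    exists (fun z => W z /\ W' z). repeat split; auto.
    + apply topen_inter; auto.
    + intros j z [<- | Hj] []; auto.
Qed.

(* Open sets are not assumed invariant under pointwise equivalence, so openness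
   is always expressed through neighbourhoods. *)
Lemma double_coset_compl_nbhd (B : subset G) w y : compact G ->
  (forall x, closure B x -> B x) -> ~ double_coset B w y ->
  exists W, topen G W /\ W y /\ forall z, W z -> ~ double_coset B w z.
Proof.
  intros comp HB Hy.
  (* A tube argument: [z] lies in [b w B] iff [w^-1 b^-1 z] lies in [B], and on a good [V] one
     neighbourhood of [y] avoids this for all [b] at once. Finitely many good sets cover [G]. *)
  set (good := fun V : G -> Prop => topen G V /\
    exists W, topen G W /\ W y /\
      forall z, W z -> forall b, V b -> B b -> ~ B (w^-1 * (b^-1 * z))).
  destruct (comp {V | good V} (fun V => proj1_sig V)) as [l Hl].
  - intros [V HV]. apply HV.
  - intros b. destruct (classic (B b)) as [Bb | Bb].
    + destruct (@not_closure B ((w^-1 * b^-1) * y)) as (O & HO & Oy & dis).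
      { intros Hc. apply Hy. apply HB in Hc. exists b, ((w^-1 * b^-1) * y).
        repeat split; auto. group. }
      destruct (@tmul_cont G O _ _ HO Oy) as (V & W & HV & HW & Vb & Wy & H).
      assert (Hcont : continuous (fun x => w^-1 * x^-1))
        by auto using continuous_mul, continuous_inv, continuous_id, continuous_const.
      destruct (Hcont V b HV Vb) as (V' & HV' & V'b & H').
      assert (gV : good V').
      { split; auto. exists W. repeat split; auto.
        intros z Wz c V'c Bc. rewrite gmulA. auto. }
      exists (exist _ V' gV). exact V'b.
    (* Compactness concerns all of [G], so points outside [B] need a good set too; an open set
       missing [B] is good vacuously. *)
    + destruct (@not_closure B b) as (O & HO & Ob & dis); [auto|].
      assert (gO : good O).
      { split; auto. exists (fun _ => True). repeat split; auto; [apply topen_full|].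
        intros z _ c Oc Bc. exfalso. eapply dis; eauto. }
      exists (exist _ O gO). exact Ob.
  - destruct (@nbhd_finite_inter _ l
      (fun V z => forall b, proj1_sig V b -> B b -> ~ B (w^-1 * (b^-1 * z))) y)
      as (W & HW & Wy & H).
    { intros [V [HV HW]] _. exact HW. }
    exists W. repeat split; auto.
    intros z Wz (b1 & b2 & H1 & H2 & ->).
    destruct (Hl b1) as (V & HV & Vb).
    apply (H V _ HV Wz b1 Vb H1). now autorewrite with grp.
Qed.

Lemma nbhd_one_finite_index (B : subset G) : compact G ->
  (exists W, topen G W /\ W gone /\ forall z, W z -> B z) -> finite_index B.
Proof.
  intros comp (W & HW & W1 & HWB).
  (* Small sets are the open sets contained in a single left coset of [B]. *)
  set (small := fun V : G -> Prop => topen G V /\ exists x, forall g, V g -> B (x^-1 * g)).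
  destruct (comp {V | small V} (fun V => proj1_sig V)) as [l Hl].
  - intros [V HV]. apply HV.
  - intros g.
    assert (Hcont : continuous (fun x => g^-1 * x))
      by auto using continuous_mul, continuous_id, continuous_const.
    destruct (Hcont W g HW) as (V & HV & Vg & H); [now rewrite gmulVl|].
    assert (sV : small V) by (split; auto; exists g; auto).
    exists (exist _ V sV). exact Vg.
  (* Finite choice of coset representatives, by induction on the subcover. *)
  - assert (Hx : exists lx : list G, forall V, In V l ->
              exists x, In x lx /\ forall g, proj1_sig V g -> B (x^-1 * g)).
    { clear Hl. induction l as [|[V [HV [x Hx]]] l [lx IH]].
      - exists nil. intros V [].
      - exists (x :: lx). intros V' [<- | HV'].
        + exists x. split; [left; reflexivity | exact Hx].
        + destruct (IH V' HV') as (x' & Hin & Hx'). exists x'. split; [right|]; auto. }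
    destruct Hx as [lx Hlx]. exists lx. intros g.
    destruct (Hl g) as (V & HV & Vg). destruct (Hlx V HV) as (x & Hx & H).
    exists x. auto.
Qed.

(** * Closedness of [B] *)

Lemma split_B_closed (B N : subset G) (S : list G) : hausdorff G ->
  is_BN_pair B N S -> BN_split B N -> forall x, closure B x -> B x.
Proof.
  intros haus BN (_ & U & [HU [n Hn]] & HUB & _ & Hdec).
  (* Putting [B] in front shifts the lower central series by one, so the trivial term [lcs U n] has
     index [Datatypes.S n]. *)
  set (E := fun i => match i with O => B | Datatypes.S j => lcs U j end).
  assert (EV : forall i a, E i a -> E i a^-1).
  { intros [|[|i]]; simpl.
    - apply (B_inv BN).
    - apply HU.
    - apply subgroup_gen. }
  assert (EU : forall i u a, U u -> E i a -> E (Datatypes.S i) (commutator G a u)).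
  { intros [|i] u a Hu Ha; simpl.
    - unfold commutator. destruct HU as (_ & HM & HV). destruct HUB as (_ & _ & _ & HJ).
      replace (a^-1 * (u^-1 * (a * u))) with ((a^-1 * (u^-1 * a)) * u) by group.
      auto.
    - intros H _ HA. apply HA. eauto. }
  (* For fixed [u] in [U], the continuous map taking [x] to its commutator with [u^-1] carries the
     closure of [E i] into that of the next term, hence into [B]. At [g^-1] its value is
     [g u g^-1 u^-1]. *)
  assert (step : forall i, (forall x, closure (E (Datatypes.S i)) x -> B x) ->
                   forall x, closure (E i) x -> B x).
  { intros i Hi g Hg. apply (conj_U_in_B BN HUB Hdec). intros u Hu.
    assert (Hg' : closure (E i) g^-1).
    { apply (@closure_map (fun x => x^-1) (E i)); auto using continuous_inv, continuous_id. }
    assert (BU : B u) by (apply HUB; exact Hu).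
    assert (Hc : B (commutator G g^-1 u^-1)).
    { apply Hi. apply (@closure_map (fun x => commutator G x u^-1) (E i)); auto.
      - unfold commutator.
        auto 10 using continuous_mul, continuous_inv, continuous_id, continuous_const.
      - intros a. apply EU, HU, Hu. }
    replace (g * (u * g^-1)) with (commutator G g^-1 u^-1 * u)
      by (unfold commutator; group).
    apply (B_mul BN); auto. }
  assert (Hlast : forall x, closure (E (Datatypes.S n)) x -> B x).
  { intros x Hx. rewrite (closure_trivial haus Hn Hx). apply (B_one BN). }
  (* Climb the chain from its trivial end; [i] counts the steps taken upwards. *)
  enough (H : forall i, i <= Datatypes.S n ->
            forall x, closure (E (Datatypes.S n - i)) x -> B x).
  { intros x Hx. apply (H (Datatypes.S n)); auto. rewrite Nat.sub_diag. exact Hx. }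
  induction i as [|i IH]; intros Hi.
  - rewrite Nat.sub_0_r. exact Hlast.
  - apply step. replace (Datatypes.S (Datatypes.S n - Datatypes.S i))
      with (Datatypes.S n - i) by lia. apply IH. lia.
Qed.

End Topology.

(** * Openness of [B] and finite index *)

Theorem theorem2 (G : TopGroup) (B N : subset G) (S : list G) :
  compact G -> hausdorff G ->
  is_BN_pair B N S -> BN_spherical B N -> BN_split B N ->
  finite_index B.
Proof.
  intros comp haus BN (l & HlN & Hl) Hsplit.
  pose proof (split_B_closed haus BN Hsplit) as Bcl.
  pose proof (@B_mul _ _ _ _ BN) as BM.
  apply nbhd_one_finite_index; auto.
  (* Sphericity leaves finitely many double cosets to avoid; those with [w] in [B] equal [B] and are
     exempted because they contain the identity. *)
  destruct (@nbhd_finite_inter G _ l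
    (fun w z => ~ B w -> ~ double_coset B w z) gone) as (W & HW & W1 & H).
  - intros w _. destruct (classic (B w)) as [Bw | Bw].
    + exists (fun _ => True). repeat split; [apply topen_full | contradiction].
    + destruct (@double_coset_compl_nbhd G B w gone comp Bcl) as (W & HW & W1 & H).
      { intros D. apply Bw. apply (double_coset_sym BN) in D.
        destruct D as (b1 & b2 & H1 & H2 & ->).
        rewrite gmul1l. auto. }
      exists W. auto.
  - exists W. repeat split; auto. intros z Wz.
    destruct (bruhat_decomposition BN z) as (n & Hn & b1 & b2 & H1 & H2 & E).
    destruct (Hl n Hn) as (w & Hw & Ht & _).
    assert (Hnw : n = w * (w^-1 * n)) by group.
    (* The representative [w] of [n] gives the same double coset, since [w^-1 * n] lies in [B]; as
       [z] avoids those outside [B], [w] must lie in [B]. *)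
    assert (Bw : B w).
    { apply NNPP. intros Bw. apply (H w z Hw Wz Bw).
      exists b1, ((w^-1 * n) * b2). repeat split; auto.
      rewrite E. group. }
    rewrite E, Hnw. auto.
Qed.
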